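(* If an equation $\varepsilon$ fails in $\mathsf{DLPG}$, then it also fails in some compatible surjection for $\varepsilon$.
   Context: $\mathsf{DLPG}$ is the variety of distributive lattice-ordered pregroups, i.e. algebras $(A,\wedge,\vee,\cdot,1,^{\ell},^{r})$ with a distributive lattice reduct and a monoid reduct whose multiplication is order-preserving, satisfying $x^{\ell}x\leq 1\leq xx^{\ell}$ and $xx^{r}\leq 1\leq x^{r}x$. Write $x^{(0)}=x$, $x^{(m)}=x^{\ell^m}$ and $x^{(-m)}=x^{r^m}$ for $m\in\mathbb{Z}^+$. An equation $\varepsilon$ over variables $x_1,\ldots,x_n$ is in intentional form if it is $1\leq w_1\vee\cdots\vee w_k$, where each $w_j$ is a (possibly empty, i.e. equal to $1$) product of terms $x_i^{(m)}$; every equation is equivalent over $\mathsf{DLPG}$ to one in intentional form, and $\varepsilon$ is assumed to be in this form. Terms are taken in the language of intentional terms (multiplication, $1$, and the iterated inverses $x_i^{(m)}$) expanded by two constants $+$ and $-$ (which in an integral chain are interpreted as the successor and predecessor maps). $FS_\varepsilon$ is the set of final subwords of $\varepsilon$: all $u$ with $w_j=vu$ for some $j$ and some $v$ (so $1\in FS_\varepsilon$). For a variable $x$, $m\in\mathbb{N}$ and $v\in FS_\varepsilon$, let $\Delta^v_{x,m}=\{v\}\cup\bigcup_{j=0}^m\{\sigma_jx^{(j)}\cdots\sigma_mx^{(m)}v:\sigma_j,\ldots,\sigma_m\in\{-1,0\},\sigma_0=0\}$ and $\Delta^v_{x,-m}=\{v\}\cup\bigcup_{j=0}^m\{\sigma_jx^{(-j)}\cdots\sigma_mx^{(-m)}v:\sigma_j,\ldots,\sigma_m\in\{1,0\},\sigma_0=0\}$,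 where $\sigma=-1$ means multiplying by the constant $-$, $\sigma=1$ multiplying by the constant $+$, and $\sigma=0$ means no factor. Let $S_\varepsilon=\{(i,m,v): i\in\{1,\ldots,n\}, m\in\mathbb{Z}, v\in FS_\varepsilon, x_i^{(m)}v\in FS_\varepsilon\}$ and $\Delta_\varepsilon=\{1\}\cup\bigcup_{(i,m,v)\in S_\varepsilon}\Delta^v_{x_i,m}$ (a finite set). A c-chain is a triple $(\Delta,\leq,\lessdot)$ where $(\Delta,\leq)$ is a finite chain and $\lessdot$ is a subset of its covering relation $\prec$ (a set of designated covering pairs). For an order-preserving partial function $g$ on a c-chain, $g^{[\ell]}$ is the relation with $(x,b)\in g^{[\ell]}$ iff $b\in Dom(g)$ and there is $a\in Dom(g)$ with $a\lessdot b$ and $g(a)<x\leq g(b)$; and $g^{[r]}$ is the relation with $(x,a)\in g^{[r]}$ iff $a\in Dom(g)$ and there is $b\in Dom(g)$ with $a\lessdot b$ and $g(a)\leq x<g(b)$ (these are order-preserving partial functions). Set $g^{[0]}=g$, $g^{[k+1]}=(g^{[k]})^{[\ell]}$, $g^{[-(k+1)]}=(g^{[-k]})^{[r]}$. A compatible surjection for $\varepsilon$ is an onto map $\varphi:\Delta_\varepsilon\to\mathbb{N}_q=\{1,\ldots,q\}$ (natural order) such that: (i) for each $i$, $g_i:=\{(\varphi(u),\varphi(x_iu)): u,x_iu\in\Delta_\varepsilon\}$ is an order-preserving partial function on $\mathbb{N}_q$; (ii) the relation $\lessdot:=\{(\varphi(v),\varphi(+v)): v,+v\in\Delta_\varepsilon\}\cup\{(\varphi(-v),\varphi(v)):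 v,-v\in\Delta_\varepsilon\}$ is contained in the covering relation $\prec$ of $\mathbb{N}_q$; (iii) $\varphi(x_i^{(m)}u)=g_i^{[m]}(\varphi(u))$ whenever $i\in\{1,\ldots,n\}$, $m\in\mathbb{Z}$ and $u,x_i^{(m)}u\in\Delta_\varepsilon$, where $g_i^{[m]}$ is computed in the c-chain $(\mathbb{N}_q,\leq,\lessdot)$. The equation $\varepsilon$ fails in $\varphi$ if $\varphi(w_1),\ldots,\varphi(w_k)<\varphi(1)$. *)

(* Defs.v *)
From HB Require Import structures.
From mathcomp Require Import all_boot all_order ssralg ssrint.
From mathcomp Require Import classical_sets.

Set Implicit Arguments.
Unset Strict Implicit.
Unset Printing Implicit Defensive.

Local Open Scope order_scope.
Local Open Scope group_scope.
Local Open Scope classical_set_scope.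

HB.mixin Record DistrLattice_Monoid_isPregroup (d : Order.disp_t) T
    of Order.DistrLattice d T & monoid.Monoid T := {
  linv : T -> T;
  rinv : T -> T;
  mul_le : forall x x' y y' : T, x <= x' -> y <= y' -> x * y <= x' * y';
  linv_mul_le1 : forall x : T, linv x * x <= (1 : T);
  le1_mul_linv : forall x : T, (1 : T) <= x * linv x;
  mul_rinv_le1 : forall x : T, x * rinv x <= (1 : T);
  le1_rinv_mul : forall x : T, (1 : T) <= rinv x * x;
}.

#[short(type="dlpgType")]
HB.structure Definition DLPG (d : Order.disp_t) :=
  {T of Order.DistrLattice d T & monoid.Monoid T
      & DistrLattice_Monoid_isPregroup d T}.

Definition iter_inv d (A : dlpgType d) (x : A) (m : int) : A :=
  match m with
  | Posz k => iter k linv x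
  | Negz k => iter k.+1 rinv x
  end.

(* [(i, m)] stands for x_i^(m); the indices of the variables start at 0. *)
Definition iword (n : nat) := seq ('I_n * int).

(* The equation 1 <= w_1 \/ ... \/ w_k, where k >= 1 since the language of
   pregroups has no constant for the empty join. *)
Record equation (n : nat) := Equation {
  first_joinand : iword n;
  other_joinands : seq (iword n) }.

Definition joinands n (e : equation n) : seq (iword n) :=
  first_joinand e :: other_joinands e.

Definition iword_eval d (A : dlpgType d) n (h : 'I_n -> A) (w : iword n) : A :=
  \prod_(p <- w) iter_inv (h p.1) p.2.

Definition join_eval d (A : dlpgType d) n (h : 'I_n -> A) (e : equation n) : A :=
  \big[Order.join/iword_eval h (first_joinand e)]_(w <- other_joinands e)
    iword_eval h w.

Definition fails_in_DLPG n (e : equation n) : Prop :=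
  exists (d : Order.disp_t) (A : dlpgType d) (h : 'I_n -> A),
    ~~ ((1 : A) <= join_eval h e).

(* Terms of the expanded language, modulo the monoid laws. *)
Inductive letter (n : nat) := X of 'I_n & int | Plus | Minus.
Arguments Plus {n}.
Arguments Minus {n}.

Definition word (n : nat) := seq (letter n).

Definition word_of n (w : iword n) : word n := [seq X p.1 p.2 | p <- w].

Definition FS n (e : equation n) : set (iword n) :=
  [set u | exists w v, w \in joinands e /\ w = v ++ u].

(* The word sigma_j x^(sgn j) ... sigma_m x^(sgn m), where sigma_k contributes
   the factor [c] if [s k] and no factor otherwise. *)
Definition sigma_word n (c : letter n) (x : nat -> letter n)
    (s : nat -> bool) (j m : nat) : word n :=
  \big[cat/[::]]_(j <= k < m.+1) ((if s k then [:: c] else [::]) ++ [:: x k]).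

Definition Delta_gen n (c : letter n) (x : nat -> letter n) (m : nat)
    (v : iword n) : set (word n) :=
  [set word_of v] `|`
  \bigcup_(j in [set j | (j <= m)%N])
    [set sigma_word c x s j m ++ word_of v | s in [set s | s 0%N = false]].

(* For m = 0 the clauses for m and for -m give the same set {v, x_i v}. *)
Definition Delta_var n (i : 'I_n) (m : int) (v : iword n) : set (word n) :=
  match m with
  | Posz k => Delta_gen Minus (fun j => X i (j%:Z)%R) k v
  | Negz k => Delta_gen Plus (fun j => X i (- j%:Z)%R) k.+1 v
  end.

Definition S_eq n (e : equation n) : set ('I_n * int * iword n) :=
  [set t | let: (i, m, v) := t in FS e v /\ FS e ((i, m) :: v)].

Definition Delta n (e : equation n) : set (word n) :=
  [set [::]] `|`
  \bigcup_(t in S_eq e) (let: (i, m, v) := t in Delta_var i m v).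

Definition covers d (T : porderType d) (a b : T) : Prop :=
  a < b /\ ~ exists c : T, a < c /\ c < b.

Definition is_cchain d (T : finOrderType d) (cov : T -> T -> Prop) : Prop :=
  forall a b, cov a b -> covers a b.

(* A partial function is represented by its graph: [g a b] means g(a) = b. *)
Definition is_partial_fun (T : Type) (g : T -> T -> Prop) : Prop :=
  forall a b b', g a b -> g a b' -> b = b'.

Definition order_preserving d (T : porderType d) (g : T -> T -> Prop) : Prop :=
  forall a a' b b', a <= a' -> g a b -> g a' b' -> b <= b'.

Section PartialInverses.
Context d (T : porderType d) (cov : T -> T -> Prop).

Definition pinvl (g : T -> T -> Prop) : T -> T -> Prop := fun x b =>
  exists a ga gb, [/\ g a ga, g b gb, cov a b, ga < x & x <= gb].

Definition pinvr (g : T -> T -> Prop) : T -> T -> Prop := fun x a =>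
  exists b ga gb, [/\ g a ga, g b gb, cov a b, ga <= x & x < gb].

Definition iter_pinv (g : T -> T -> Prop) (m : int) : T -> T -> Prop :=
  match m with
  | Posz k => iter k pinvl g
  | Negz k => iter k.+1 pinvr g
  end.

End PartialInverses.

(* [phi] only matters on [Delta e]; 'I_q is {0, ..., q-1} in its natural order
   and plays the role of the chain {1, ..., q}. *)
Section CompatibleSurjection.
Context n (e : equation n) (q : nat) (phi : word n -> 'I_q).

Definition g_of (i : 'I_n) (a b : 'I_q) : Prop :=
  exists u, [/\ Delta e u, Delta e (X i 0%R :: u),
    a = phi u & b = phi (X i 0%R :: u)].

Definition cov_of (a b : 'I_q) : Prop :=
  (exists v, [/\ Delta e v, Delta e (Plus :: v),
     a = phi v & b = phi (Plus :: v)]) \/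
  (exists v, [/\ Delta e v, Delta e (Minus :: v),
     a = phi (Minus :: v) & b = phi v]).

Definition compatible_surjection : Prop :=
  [/\ forall y : 'I_q, exists2 u, Delta e u & phi u = y,
      forall i, is_partial_fun (g_of i) /\ order_preserving (g_of i),
      is_cchain cov_of
    & forall (i : 'I_n) (m : int) (u : word n),
        Delta e u -> Delta e (X i m :: u) ->
        iter_pinv cov_of (g_of i) m (phi u) (phi (X i m :: u))].

Definition fails_in_surjection : Prop :=
  forall w, w \in joinands e -> phi (word_of w) < phi [::].

End CompatibleSurjection.

(* Main.v *)
(* Let P be a prime filter of a distributive l-pregroup that contains 1 but not
   the value of the join. Since multiplication distributes over joins and meets,
   the preorder "b x in P implies b y in P for all b" is total, and the maps
   y |-> x^(m) y form a sequence of consecutive adjoints on the resulting chain.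
   These adjoints extend to an integral chain, in which every word over the
   variables, + and - can be evaluated starting from 1. The values of the finitely
   many words of Delta form a finite chain, and their ranks give the surjection.
   In an integral chain b = f^(m+1)(z) iff f^(m)(b - 1) < z <= f^(m)(b), and Delta
   contains the words for b - 1, f^(m)(b - 1) and f^(m)(b) along with that for b:
   this turns the adjoints into the partial ones by induction on |m|. *)

Require Import Defs.
From mathcomp Require Import all_boot all_order ssralg ssrnum ssrint.
From mathcomp Require Import boolp classical_sets cardinality zify.

Set Implicit Arguments.
Unset Strict Implicit.
Unset Printing Implicit Defensive.

Import Order.Theory Num.Theory.

(** * Total preorders and ranks of finite subsets *)

Definition total_preorder (T : Type) (le : T -> T -> Prop) : Prop :=
  (forall y x z, le x y -> le y z -> le x z) /\
  (forall x y, le x y \/ le y x).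

Section TotalPreorder.
Context (T : Type) (le : T -> T -> Prop).
Hypothesis le_preorder : total_preorder le.

Lemma tle_trans y x z : le x y -> le y z -> le x z.
Proof. exact: le_preorder.1. Qed.

Lemma tle_refl x : le x x.
Proof. by case: (le_preorder.2 x x). Qed.

Lemma tnle_le x y : ~ le x y -> le y x.
Proof. by case: (le_preorder.2 x y). Qed.

Lemma total_preorder_flip : total_preorder (fun x y => le y x).
Proof.
by split=> [y x z xy yz|x y]; [apply: tle_trans xy|apply: le_preorder.2].
Qed.

End TotalPreorder.

(** The number of elements of [D] strictly below [u] already determines its place in the order;
    sorting these numbers without repetition and taking indices closes the gaps, which makes [phi]
    onto. The point [w0] ensures that ['I_q] is inhabited. *)
Lemma rank_exists (W : Type) (le : W -> W -> Prop) (D : set W) (w0 : W) :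
  total_preorder le -> finite_set D -> D w0 ->
  exists (q : nat) (phi : W -> 'I_q),
    (forall y, exists2 u, D u & phi u = y) /\
    (forall u v, D u -> D v -> (phi u <= phi v)%N <-> le u v).
Proof.
(* Classically [W] carries a choice structure, so [undup] and membership in sequences are
   available. *)
elim/Pchoice: W => W in le D w0 *; move=> tle /finite_seqP[s Ds] Dw0.
have inD u : D u <-> u \in undup s by rewrite mem_undup Ds.
pose lt u v := `[< ~ le v u >].
pose below u := [seq x <- undup s | lt x u].
pose r u := size (below u).
have r_le u v : D u -> D v -> (r u <= r v)%N <-> le u v.
  move=> Du Dv; split=> [|uv]; last first.
    rewrite /r !size_filter; apply: sub_count => x /asboolP xu; apply/asboolP.
    by apply: contra_not xu; apply: tle_trans uv.
  apply: contraPP => nuv; apply/negP; rewrite -ltnNge.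
  (* When [v] is strictly below [u], it joins all of [below v] inside [below u], so the count grows
     strictly. *)
  rewrite -[(r v).+1]/(size (v :: below v)); apply: uniq_leq_size.
    rewrite /= filter_uniq ?undup_uniq// andbT mem_filter; apply/negP.
    by case/andP=> /asboolP; case; apply: tle_refl.
  move=> x; rewrite inE => /predU1P[->|]; rewrite !mem_filter.
    by rewrite (iffLR (inD v) Dv) andbT; apply/asboolP.
  move=> /andP[/asboolP xv ->]; rewrite andbT; apply/asboolP.
  by apply: contra_not xv => ux; apply: tle_trans (tnle_le tle nuv) ux.
pose t := sort leq (undup [seq r u | u <- s]).
have t_uniq : uniq t by rewrite sort_uniq undup_uniq.
have t_sorted : sorted leq t by apply: sort_sorted; apply: leq_total.
have r_t u : D u -> r u \in t.
  by move=> /inD; rewrite mem_undup => us; rewrite mem_sort mem_undup map_f.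
have t_gt0 : (0 < size t)%N by case: (t) (r_t _ Dw0).
(* The default value is never taken on [D]. *)
pose phi u := insubd (Ordinal t_gt0) (index (r u) t).
have phiE u : D u -> phi u = index (r u) t :> nat.
  by move=> Du; rewrite val_insubd index_mem r_t.
exists (size t), phi; split=> [y|u v Du Dv].
  have : nth 0 t y \in t by rewrite mem_nth.
  rewrite mem_sort mem_undup => /mapP[u us ru].
  have Du : D u by apply/inD; rewrite mem_undup.
  by exists u => //; apply/val_inj; rewrite /= phiE// -ru index_uniq.
rewrite !phiE//; apply: iff_trans (r_le u v Du Dv); split.
  by apply: (sorted_leq_index leq_trans) => //; apply: r_t.
rewrite leqNgt => /negP uv; rewrite leqNgt; apply/negP => vu; apply: uv.
rewrite ltn_neqAle (sorted_leq_index leq_trans leqnn t_sorted) ?r_t ?(ltnW vu)//.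
by rewrite andbT; apply/eqP => eq_r; rewrite eq_r ltnn in vu.
Qed.

(** * Prime filters in distributive lattices *)

Section PrimeFilter.
Context (d : Order.disp_t) (A : distrLatticeType d).
Local Open Scope classical_set_scope.
Local Open Scope order_scope.

(** Zorn's lemma gives a filter maximal among those containing [a] and avoiding [b]. If it contained
    a join but neither joinand, maximality would give [f] and [g] in it whose meets with the
    respective joinands lie below [b], and distributivity would put [b] in the filter. *)
Lemma prime_filter_exists (a b : A) : ~~ (a <= b) ->
  exists P : set A, [/\ P a, ~ P b,
    (forall x y, x <= y -> P x -> P y),
    (forall x y, P x -> P y -> P (x `&` y)) &
    (forall x y, P (x `|` y) -> P x \/ P y)].
Proof.
move=> ab.
pose proper_filter (F : set A) := [/\ F a, ~ F b,
  (forall x y, x <= y -> F x -> F y) & (forall x y, F x -> F y -> F (x `&` y))].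
(* The empty set is admitted as the union of the empty chain. *)
have [|M [M0F Mmax]] := @Zorn_bigcup A (fun F => F = set0 \/ proper_filter F).
  move=> /= C CF Ctot.
  have [[F0 CF0 F0ne]|none] := pselect (exists2 F, C F & F <> set0); last first.
    left; apply/seteqP; split=> // x [F CF' Fx]; case: none; exists F => //.
    by move=> F0; rewrite F0 in Fx.
  right; have filt F x : C F -> F x -> proper_filter F.
    by move=> /CF[->|].
  split.
  - by exists F0 => //; case: (CF _ CF0) => [//|[]].
  - by move=> [F FC Fb]; case: (filt _ _ FC Fb).
  - move=> x y xy [F FC Fx]; exists F => //.
    by case: (filt _ _ FC Fx) => _ _ up _; apply: up Fx.
  - move=> x y [F FC Fx] [G GC Gy].
    have [FG|GF] := Ctot _ _ FC GC.
      exists G => //; case: (filt _ _ GC Gy) => _ _ _; apply=> //; exact: FG.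
    exists F => //; case: (filt _ _ FC Fx) => _ _ _; apply=> //; exact: GF.
have MF : proper_filter M.
  (* The empty set is not maximal, as the principal filter of [a] is larger. *)
  case: M0F => // M0; exfalso; apply: (Mmax [set x | a <= x]).
    rewrite M0; split=> [//|/(_ a)]; rewrite /= lexx => H; exact: H.
  right; split=> /=; [exact: lexx|exact/negP| |].
    by move=> x y xy /le_trans; apply.
  by move=> x y ax ay; rewrite lexI ax.
have [Ma Mb Mup MI] := MF.
exists M; split=> // x y Mxy.
have escape z : ~ M z -> exists2 f, M f & f `&` z <= b.
  move=> Mz; apply: contrapT => nb.
  (* The filter generated by [M] and [z] properly extends [M] and would still avoid [b]. *)
  apply: (Mmax [set u | exists2 f, M f & f `&` z <= u]).
    split=> [u Mu|/(_ z)]; first by exists u => //; apply: leIl.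
    by move=> H; apply/Mz/H; exists a => //; apply: leIr.
  right; split=> /=; first by exists a => //; apply: leIl.
  - by move=> [f Mf fb]; apply: nb; exists f.
  - by move=> u v uv [f Mf fu]; exists f => //; apply: le_trans uv.
  - move=> u v [f Mf fu] [g Mg gv]; exists (f `&` g); first exact: MI.
    rewrite lexI (le_trans _ fu) ?(le_trans _ gv)// leI2 ?leIl ?leIr//.
apply: contrapT => /not_orP[/escape[f Mf fb] /escape[g Mg gb]].
apply/Mb/(Mup _ _ _ (MI _ _ (MI _ _ Mf Mg) Mxy)).
rewrite meetUr leUx (le_trans _ fb) ?(le_trans _ gb)// leI2 ?leIl ?leIr//.
Qed.

End PrimeFilter.

(** * Inequalities in distributive lattice-ordered pregroups *)

Section LatticePregroupInequalities.
Context (d : Order.disp_t) (A : dlpgType d).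
Local Open Scope group_scope.
Local Open Scope order_scope.
Implicit Types x y z : A.

Lemma le_mul2l z x y : x <= y -> z * x <= z * y.
Proof. by move=> xy; apply: mul_le. Qed.

Lemma le_mul2r z x y : x <= y -> x * z <= y * z.
Proof. by move=> xy; apply: mul_le. Qed.

(** Left multiplication by [z] is right adjoint to left multiplication by [linv z], hence preserves
    meets. *)
Lemma meet_mul_le z x y : (z * x) `&` (z * y) <= z * (x `&` y).
Proof.
set t := _ `&` _.
have ub : linv z * t <= x `&` y.
  rewrite lexI; apply/andP; split.
    apply: (le_trans (le_mul2l _ (leIl _ _))).
    by rewrite mulgA -[leRHS]mul1g le_mul2r// linv_mul_le1.
  apply: (le_trans (le_mul2l _ (leIr _ _))).
  by rewrite mulgA -[leRHS]mul1g le_mul2r// linv_mul_le1.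
apply: le_trans (le_mul2l z ub).
by rewrite mulgA -[leLHS]mul1g le_mul2r// le1_mul_linv.
Qed.

(** Right multiplication by [z] is left adjoint to right multiplication by [linv z], hence preserves
    joins. *)
Lemma mul_join_le z x y : (x `|` y) * z <= (x * z) `|` (y * z).
Proof.
set t := (_ * _) `|` _.
have ub : x `|` y <= t * linv z.
  rewrite leUx; apply/andP; split.
    apply: le_trans (le_mul2r _ (leUl _ _)).
    by rewrite -mulgA -[leLHS]mulg1 le_mul2l// le1_mul_linv.
  apply: le_trans (le_mul2r _ (leUr _ _)).
  by rewrite -mulgA -[leLHS]mulg1 le_mul2l// le1_mul_linv.
apply: (le_trans (le_mul2r z ub)).
by rewrite -mulgA -[leRHS]mulg1 le_mul2l// linv_mul_le1.
Qed.

(* Compare both sides with [(x `|` y) * (u `&` v)]. *)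
Lemma meet_mul_le_join_mul x y u v :
  (x * u) `&` (y * v) <= (x * v) `|` (y * u).
Proof.
apply: (@le_trans _ _ ((x `|` y) * (u `&` v))).
  by apply: le_trans (meet_mul_le _ _ _); rewrite leI2 ?le_mul2r ?leUl ?leUr.
by apply: (le_trans (mul_join_le _ _ _)); rewrite leU2 ?le_mul2l ?leIl ?leIr.
Qed.

(** With the next lemma, left multiplication by x^(m+1) is left adjoint to that by x^(m), uniformly
    in the sign of [m]. *)
Lemma iter_invS_mul_le1 x (m : int) : iter_inv x (m + 1)%R * iter_inv x m <= 1.
Proof.
case: m => k; first by rewrite (_ : k%:Z + 1 = k.+1%:Z)%R; [|lia]; apply: linv_mul_le1.
rewrite (_ : Negz k + 1 = - k%:Z)%R; [|lia]; case: k => [|k].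
  exact: mul_rinv_le1.
by rewrite -NegzE; apply: mul_rinv_le1.
Qed.

Lemma le1_mul_iter_invS x (m : int) : 1 <= iter_inv x m * iter_inv x (m + 1)%R.
Proof.
case: m => k; first by rewrite (_ : k%:Z + 1 = k.+1%:Z)%R; [|lia]; apply: le1_mul_linv.
rewrite (_ : Negz k + 1 = - k%:Z)%R; [|lia]; case: k => [|k].
  exact: le1_rinv_mul.
by rewrite -NegzE; apply: le1_rinv_mul.
Qed.

Lemma join_eval_ge n (h : 'I_n -> A) (e : equation n) w :
  w \in joinands e -> iword_eval h w <= join_eval h e.
Proof.
rewrite /joinands /join_eval inE.
case/predU1P=> [->|].
  elim: (other_joinands e) => [|v s IH]; first by rewrite big_nil.
  by rewrite big_cons (le_trans IH)// leUr.
elim: (other_joinands e) => [//|v s IH]; rewrite inE big_cons.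
case/predU1P=> [->|/IH wle]; first exact: leUl.
by rewrite (le_trans wle)// leUr.
Qed.

End LatticePregroupInequalities.

(** * Upper covers and adjoint maps in a total preorder *)

Section UpperCovers.
Context (T : Type) (le : T -> T -> Prop).
Hypothesis tle : total_preorder le.

(** In a total preorder [~ le y x] says that [y] is strictly above [x]. *)
Definition upper_cover (x y : T) : Prop :=
  ~ le y x /\ forall z, ~ le z x -> le y z.

(** For monotone [f], this means being constant up to equivalence on an interval that starts at [x]
    and extends strictly above it. *)
Definition flat_above (f : T -> T) (x : T) : Prop :=
  exists2 y, ~ le y x & le (f y) (f x).

Definition no_upper_cover (x : T) : Prop := ~ exists y, upper_cover x y.

Lemma no_upper_cover_le x y :
  no_upper_cover x -> (forall z, ~ le z x -> le y z) -> le y x.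
Proof. by move=> nx ylb; apply: contrapT => yx; apply: nx; exists y. Qed.

(** Without an upper cover, [x] is the infimum of the points strictly above it. The right adjoint
    [f] preserves this infimum and, not being flat, sends those points strictly above [f x], so a
    cover of [f x] would lie below [f x]. *)
Lemma no_upper_cover_image (f g : T -> T) x :
  {homo f : a b / le a b} -> {homo g : a b / le a b} ->
  (forall a, le (g (f a)) a) -> (forall a, le a (f (g a))) ->
  no_upper_cover x -> ~ flat_above f x -> no_upper_cover (f x).
Proof.
move=> f_homo g_homo gf fg nx nflat [y [nyfx ylb]]; apply: nyfx.
apply: (tle_trans tle (fg y)); apply: f_homo; apply: no_upper_cover_le => // z zx.
apply: (tle_trans tle _ (gf z)); apply: g_homo; apply: ylb => fzx.
by apply: nflat; exists z.
Qed.

(** Let [f x] be below [f (g y)], hence below [y]. Each [z] strictly above [y] has [x] below [g z],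
    since otherwise [z] would be below [f (g z)], thus below [f x] and [y]. By the adjunction [h x]
    is below all such [z], hence below their infimum [y], and so [x] is below [g y]. *)
Lemma not_flat_above_adjoint (f g h : T -> T) y :
  {homo f : a b / le a b} -> {homo g : a b / le a b} ->
  {homo h : a b / le a b} -> (forall a, le a (f (g a))) ->
  (forall a, le (h (g a)) a) -> (forall a, le a (g (h a))) ->
  no_upper_cover y -> ~ flat_above g y -> le (f (g y)) y -> ~ flat_above f (g y).
Proof.
move=> f_homo g_homo h_homo fg hg gh ny nflat fgy [x nxgy fx]; apply: nxgy.
apply: (tle_trans tle (gh x)); apply: g_homo; apply: no_upper_cover_le => // z zy.
apply: (tle_trans tle _ (hg z)); apply: h_homo; apply: contrapT => /(tnle_le tle) gzx.
apply/zy/(tle_trans tle (fg z))/(tle_trans tle _ fgy)/(tle_trans tle _ fx).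
exact: f_homo.
Qed.

End UpperCovers.

(** * Extension of a chain to an integral chain *)

(* The integral chain is the set of points [(x, k)] in lexicographic order where
   [k > 0] only if [x] has no upper cover and [k < 0] only if [x] has no lower
   cover. A map lifts by [(x, k) |-> (f x, k)], except that it collapses the new
   points of [x] on a side where it is locally constant. *)
Section IntegralExtension.
Context (T : Type) (le : T -> T -> Prop).
Hypothesis tle : total_preorder le.
Local Open Scope ring_scope.
Local Notation ge := (fun x y => le y x).
Let tge : total_preorder ge := total_preorder_flip tle.

Definition ext_point (p : T * int) : Prop :=
  (0 < p.2 -> no_upper_cover le p.1) /\ (p.2 < 0 -> no_upper_cover ge p.1).

Definition ext_le (p q : T * int) : Prop :=
  le p.1 q.1 /\ (le q.1 p.1 -> p.2 <= q.2).

Lemma ext_le_preorder : total_preorder ext_le.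
Proof.
split=> [[y j] [x i] [z k]|[x i] [y j]]; rewrite /ext_le /=.
  move=> [xy ij] [yz jk]; split=> [|zx]; first exact: (tle_trans tle xy).
  have := ij (tle_trans tle yz zx); have := jk (tle_trans tle zx xy); lia.
have [xy|nxy] := pselect (le x y); last first.
  by right; split=> [|//]; apply: tnle_le.
have [yx|nyx] := pselect (le y x); last by left.
by case: (lerP i j) => ij; [left|right]; split=> // _; lia.
Qed.

(** The successor of [(x, 0)] is [(y, 0)] if [y] covers [x]: no new points lie above [x] or below
    [y]. In all other cases the successor of [(x, k)] is [(x, k + 1)]. *)
Lemma ext_succ_exists p : ext_point p ->
  exists q, [/\ ext_point q, ~ ext_le q p &
    forall z, ext_point z -> ~ ext_le z p -> ext_le q z].
Proof.
case: p => x k [/= nup ndown].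
have [[k0 [y [nyx ylb]]]|hup] :=
    pselect (k = 0 /\ exists y, upper_cover le x y).
  subst k; exists (y, 0); split=> [//|[]//|[z j] [/= zup zdown] nz] /=.
  have [zx|nzx] := pselect (le z x).
    exfalso; apply: nz; split=> //= xz; rewrite leNgt; apply/negP => /zup.
    apply; exists y; split=> [yz|w nwz]; first exact/nyx/(tle_trans tle yz).
    by apply: ylb => wx; apply/nwz/(tle_trans tle wx).
  split=> /= [|zy]; first exact: ylb.
  rewrite leNgt; apply/negP => /zdown; apply; exists x; split=> //= w nzw.
  by apply: contrapT => /ylb; apply: contra_not nzw; apply: tle_trans zy.
exists (x, k + 1); split=> [|[] /= _ /(_ (tle_refl tle x))|[z j] _ /=].
- split=> /= k1; last by apply: ndown; lia.
  have [k0|/eqP k0] := eqVneq k 0; last by apply: nup; lia.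
  by move=> hy; apply: hup.
- lia.
- move=> nz; split=> /= [|zx].
    by apply: contrapT => nxz; apply: nz; split=> //=; apply: tnle_le.
  rewrite leNgt; apply/negP => jk; apply: nz; split=> //= _; lia.
Qed.

Definition lift_height (f : T -> T) (x : T) (k : int) : int :=
  if `[< (0 < k /\ flat_above le f x) \/ (k < 0 /\ flat_above ge f x) >]
  then 0 else k.

Definition lift (f : T -> T) (p : T * int) : T * int :=
  (f p.1, lift_height f p.1 p.2).

Lemma lift_height_ge0 f x k : 0 <= k -> 0 <= lift_height f x k <= k.
Proof. by rewrite /lift_height; case: ifP => _; lia. Qed.

Lemma lift_height_le0 f x k : k <= 0 -> k <= lift_height f x k <= 0.
Proof. by rewrite /lift_height; case: ifP => _; lia. Qed.

Lemma lift_height_flat_above f x k : flat_above le f x -> lift_height f x k <= 0.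
Proof.
move=> fx; have [/(lift_height_le0 f x)/andP[]//|k0] := leP k 0.
by rewrite /lift_height asboolT//; left.
Qed.

Lemma lift_height_flat_below f x k : flat_above ge f x -> 0 <= lift_height f x k.
Proof.
move=> fx; have [/(lift_height_ge0 f x)/andP[]//|k0] := leP 0 k.
by rewrite /lift_height asboolT//; right.
Qed.

Lemma lift_height_id f x k : (0 < k -> ~ flat_above le f x) ->
  (k < 0 -> ~ flat_above ge f x) -> lift_height f x k = k.
Proof.
by move=> up down; rewrite /lift_height; case: asboolP => // -[[/up n /n]|[/down n /n]].
Qed.

Lemma lift_height_homo f x : {homo lift_height f x : i j / i <= j}.
Proof.
move=> i j ij; have [i0|i0] := leP i 0.
  have [j0|j0] := leP 0 j.
    by have := lift_height_le0 f x i0; have := lift_height_ge0 f x j0; lia.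
  have [fx|nfx] := pselect (flat_above ge f x).
    have := lift_height_flat_below i fx; have := lift_height_flat_below j fx.
    by have := lift_height_le0 f x i0; have := lift_height_le0 f x (ltW j0); lia.
  by rewrite !lift_height_id// => ?; lia.
have [fx|nfx] := pselect (flat_above le f x); last by rewrite !lift_height_id// => ?; lia.
have := lift_height_flat_above i fx.
have j0 : 0 <= j by lia.
by have := lift_height_ge0 f x j0; lia.
Qed.

Lemma lift_homo f : {homo f : x y / le x y} ->
  {homo lift f : p q / ext_le p q}.
Proof.
move=> f_homo [x i] [y j] [/= xy ij]; split=> /= [|fyx]; first exact: f_homo.
(* If [x] is strictly below [y] but their images are equivalent, [f] is flat above [x] and below
   [y], so 0 separates the two heights. *)
have [yx|nyx] := pselect (le y x); last first.
  have fx : flat_above le f x by exists y.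
  have fy : flat_above ge f y by exists x.
  exact: le_trans (lift_height_flat_above i fx) (lift_height_flat_below j fy).
have flatE : flat_above le f x <-> flat_above le f y.
  split=> -[z nz fz]; exists z.
  - by apply: contra_not nz => zy; apply: (tle_trans tle zy).
  - by apply: (tle_trans tle fz); apply: f_homo.
  - by apply: contra_not nz => zx; apply: (tle_trans tle zx).
  - by apply: (tle_trans tle fz); apply: f_homo.
have flatE' : flat_above ge f x <-> flat_above ge f y.
  split=> -[z nz fz]; exists z.
  - by apply: contra_not nz => zy; apply: (tle_trans tle xy).
  - by apply: (tle_trans tle _ fz); apply: f_homo.
  - by apply: contra_not nz => zy; apply: (tle_trans tle yx).
  - by apply: (tle_trans tle _ fz); apply: f_homo.
rewrite [leRHS]/lift_height -(propext flatE) -(propext flatE').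
exact: (@lift_height_homo f x i j (ij yx)).
Qed.

Section AdjointSequence.
Context (f : int -> T -> T).
Hypothesis f_homo : forall m, {homo f m : x y / le x y}.
Hypothesis f_unit : forall m x, le x (f m (f (m + 1) x)).
Hypothesis f_counit : forall m x, le (f (m + 1) (f m x)) x.

Let ge_homo m : {homo f m : x y / ge x y}.
Proof. by move=> x y; apply: f_homo. Qed.

Let f_unit' m x : le x (f (m - 1) (f m x)).
Proof. by have := f_unit (m - 1) x; rewrite GRing.subrK. Qed.

Let f_counit' m x : le (f m (f (m - 1) x)) x.
Proof. by have := f_counit (m - 1) x; rewrite GRing.subrK. Qed.

(** A positive height survives only where [f m] is not flat above, and there the absence of upper
    covers is inherited through the left adjoint [f (m + 1)]. Negative heights are dual, through
    [f (m - 1)]. *)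
Lemma lift_ext_point m p : ext_point p -> ext_point (lift (f m) p).
Proof.
case: p => x k [/= nup ndown]; rewrite /lift /lift_height.
case: asboolP => /= [//|/not_orP[nfu nfd]]; split=> /= k0.
  apply: (@no_upper_cover_image _ _ tle (f m) (f (m + 1))) => //; first exact: nup.
  by move=> fu; apply: nfu.
apply: (@no_upper_cover_image _ _ tge (f m) (f (m - 1))) => //; first exact: ndown.
by move=> fd; apply: nfd.
Qed.

(** Lifting moves heights only towards 0, so the critical case is a positive height with
    [f m (f (m + 1) x)] equivalent to [x]. There neither map is flat above its argument, so the
    height is kept twice. *)
Lemma lift_unit m p : ext_point p ->
  ext_le p (lift (f m) (lift (f (m + 1)) p)).
Proof.
case: p => x k [/= nup ndown]; split=> /= [//|fx].
have [k0|k0] := leP k 0.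
  have /andP[kh h0] := lift_height_le0 (f (m + 1)) x k0.
  by apply: (le_trans kh); case/andP: (lift_height_le0 (f m) (f (m + 1) x) h0).
have ng : ~ flat_above le (f (m + 1)) x.
  move=> [y nyx gy]; apply/nyx/(tle_trans tle _ fx)/(tle_trans tle (f_unit m y)).
  exact: f_homo.
have nf : ~ flat_above le (f m) (f (m + 1) x).
  apply: (@not_flat_above_adjoint _ _ tle _ _ (f (m + 1 + 1))) => //.
  exact: nup.
by rewrite !lift_height_id// => ?; lia.
Qed.

(** The order dual of [lift_unit]: the critical heights are negative, and [f (m - 1)] is the third
    adjoint. *)
Lemma lift_counit m p : ext_point p ->
  ext_le (lift (f (m + 1)) (lift (f m) p)) p.
Proof.
case: p => x k [/= nup ndown]; split=> /= [//|fx].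
have [k0|k0] := leP 0 k.
  have /andP[h0 hk] := lift_height_ge0 (f m) x k0.
  by apply: le_trans hk; case/andP: (lift_height_ge0 (f (m + 1)) (f m x) h0).
have ng : ~ flat_above ge (f m) x.
  move=> [y nyx gy]; apply/nyx/(tle_trans tle fx)/(tle_trans tle _ (f_counit m y)).
  exact: f_homo.
have nf : ~ flat_above ge (f (m + 1)) (f m x).
  apply: (@not_flat_above_adjoint _ _ tge _ _ (f (m - 1))) => //.
  exact: ndown.
by rewrite !lift_height_id// => ?; lia.
Qed.

End AdjointSequence.

End IntegralExtension.

(** Negating heights is an anti-isomorphism onto the extension of the reversed chain, where
    predecessors become successors. *)
Lemma ext_pred_exists (T : Type) (le : T -> T -> Prop) p :
  total_preorder le -> ext_point le p ->
  exists q, [/\ ext_point le q, ~ ext_le le p q &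
    forall z, ext_point le z -> ~ ext_le le p z -> ext_le le z q].
Proof.
move=> tle pP; pose opp (r : T * int) := (r.1, (- r.2)%R).
have oppK : involutive opp by case=> x k; rewrite /opp /= GRing.opprK.
have opp_point r : ext_point le r -> ext_point (fun x y => le y x) (opp r).
  by case: r => x k [/= up down]; split=> /= k0; [apply: down|apply: up]; lia.
have opp_le r s : ext_le le r s <-> ext_le (fun x y => le y x) (opp s) (opp r).
  by split=> -[/= rs h]; split=> //= /h; lia.
have [q [qP qp qmin]] :=
  ext_succ_exists (total_preorder_flip tle) (opp_point _ pP).
exists (opp q); split.
- by case: q qP {qp qmin} => x k [/= up down]; split=> /= k0; [apply: down|apply: up]; lia.
- by rewrite opp_le oppK.
- by move=> z /opp_point zP npz; rewrite opp_le oppK; apply: qmin => //; rewrite -opp_le.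
Qed.

(** * Finiteness and closure properties of [Delta] *)

Section SigmaWords.
Context (n : nat).
Local Open Scope classical_set_scope.
Implicit Types (c : letter n) (x : nat -> letter n) (s : nat -> bool).

Lemma sigma_word_recl c x s j m : (j <= m)%N ->
  sigma_word c x s j m =
  (if s j then [:: c] else [::]) ++ x j :: sigma_word c x s j.+1 m.
Proof. by move=> jm; rewrite /sigma_word big_ltn // -catA. Qed.

Lemma sigma_word_nil c x s m : sigma_word c x s m.+1 m = [::].
Proof. by rewrite /sigma_word big_geq. Qed.

Lemma eq_sigma_word c x s s' j m : (forall k, (j <= k <= m)%N -> s k = s' k) ->
  sigma_word c x s j m = sigma_word c x s' j m.
Proof. by move=> ss'; apply: eq_big_nat => k ?; rewrite ss'. Qed.

Definition set_sign s (k : nat) (b : bool) : nat -> bool :=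
  fun j => if j == k then b else s j.

Lemma sigma_word_set_sign c x s k b j m : (k < j)%N ->
  sigma_word c x (set_sign s k b) j m = sigma_word c x s j m.
Proof.
by move=> kj; apply: eq_sigma_word => i ?; rewrite /set_sign; case: eqP => //; lia.
Qed.

Lemma Delta_gen_sigma_word c x s j m (v : iword n) :
  s 0%N = false -> (j <= m)%N ->
  Delta_gen c x m v (sigma_word c x s j m ++ word_of v).
Proof. by move=> s0 jm; right; exists j => //; exists s. Qed.

Lemma Delta_gen_last c x m (v : iword n) : Delta_gen c x m v (x m :: word_of v).
Proof.
have := @Delta_gen_sigma_word c x xpred0 m m v erefl (leqnn m).
by rewrite sigma_word_recl// sigma_word_nil.
Qed.

Lemma Delta_gen_finite c x m v : finite_set (Delta_gen c x m v).
Proof.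
rewrite /Delta_gen finite_setU; split; first exact: finite_set1.
apply: bigcup_finite => [|j _].
  apply: (@sub_finite_set _ _ [set` iota 0 m.+1]); last by apply/finite_seqP; eexists.
  by move=> j jm; change (j \in iota 0 m.+1); rewrite mem_iota.
(* Only the signs at indices up to [m] affect the word. *)
pose F (t : {ffun 'I_m.+1 -> bool}) :=
  sigma_word c x (fun k => t (inord k)) j m ++ word_of v.
apply: (@sub_finite_set _ _ (F @` setT)); last exact/finite_image/finite_finset.
move=> _ [s _ <-]; exists [ffun i => s (val i)] => //; congr (_ ++ _).
by apply: eq_sigma_word => k /andP[_ km]; rewrite ffunE /= inordK.
Qed.

Lemma Delta_var_finite i (m : int) (v : iword n) : finite_set (Delta_var i m v).
Proof. by case: m => k; apply: Delta_gen_finite. Qed.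

Lemma FS_finite (e : equation n) : finite_set (FS e).
Proof.
pose s := flatten [seq [seq drop k w | k <- iota 0 (size w).+1] | w <- joinands e].
apply: (@sub_finite_set _ _ [set` s]); last by apply/finite_seqP; exists s.
move=> u [w [v [we wE]]] /=; apply/flatten_mapP; exists w => //; apply/mapP.
exists (size v); last by rewrite wE drop_size_cat.
by rewrite mem_iota add0n ltnS wE size_cat; apply: leq_addr.
Qed.

Lemma Delta_finite (e : equation n) : finite_set (Delta e).
Proof.
rewrite /Delta finite_setU; split; first exact: finite_set1.
(* A triple of [S_eq] is encoded by the final subword [(i, m) :: v], so the union may be indexed by
   the finite set [FS e]. *)
pose F (u : iword n) :=
  if u is p :: v then Delta_var p.1 p.2 v else set0.
apply: (@sub_finite_set _ _ (\bigcup_(u in FS e) F u)).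
  by move=> u [[[i m] v] [_ FSv] uD]; exists ((i, m) :: v).
apply: bigcup_finite => [|[|[i m] v] _] /=; [exact: FS_finite|exact: finite_set0|].
exact: Delta_var_finite.
Qed.

Lemma Delta_S_eq (e : equation n) i m v u :
  S_eq e (i, m, v) -> Delta_var i m v u -> Delta e u.
Proof. by move=> S u_var; right; exists (i, m, v). Qed.

Lemma S_eq_cons (e : equation n) i m v : FS e ((i, m) :: v) -> S_eq e (i, m, v).
Proof.
move=> FSv; split=> //; case: FSv => w [t [we wE]].
by exists w, (t ++ [:: (i, m)]); rewrite -catA.
Qed.

(** The sign at [k + 1] can be chosen freely, because only the sign at 0 is constrained; [t b] sets
    it to [b] and clears the sign at [k]. *)
Lemma Delta_gen_closed c x s k m (v : iword n) (w : word n) :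
  s 0%N = false -> (k < m)%N -> w = x k.+1 :: sigma_word c x s k.+2 m ++ word_of v ->
  [/\ Delta_gen c x m v (c :: w), Delta_gen c x m v (x k :: w)
    & Delta_gen c x m v (x k :: c :: w)].
Proof.
move=> s0 km ->.
pose t b := set_sign (set_sign s k false) k.+1 b.
have t0 b : t b 0%N = false by rewrite /t /set_sign /=; case: eqP.
have wE b : (if b then [:: c] else [::]) ++
    x k.+1 :: sigma_word c x s k.+2 m ++ word_of v =
    sigma_word c x (t b) k.+1 m ++ word_of v.
  rewrite [in RHS]sigma_word_recl// /t !sigma_word_set_sign// -catA /=.
  by rewrite /set_sign eqxx; case: b.
have xwE b : x k :: (if b then [:: c] else [::]) ++
    x k.+1 :: sigma_word c x s k.+2 m ++ word_of v =
    sigma_word c x (t b) k m ++ word_of v.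
  rewrite wE [in RHS]sigma_word_recl ?(ltnW km)// -catA /=.
  by rewrite /t /set_sign eqxx ltn_eqF.
split.
- by rewrite -[_ :: _]/([:: c] ++ _) (wE true); apply: Delta_gen_sigma_word.
- by rewrite (xwE false); apply: Delta_gen_sigma_word => //; apply: ltnW.
- by rewrite (xwE true); apply: Delta_gen_sigma_word => //; apply: ltnW.
Qed.

Lemma Delta_gen_consX c x m (v : iword n) i k u :
  (forall i k, c <> X i k) -> Delta_gen c x m v (X i k :: u) ->
  word_of v = X i k :: u \/
  exists j s, [/\ (j <= m)%N, s 0%N = false, x j = X i k
    & u = sigma_word c x s j.+1 m ++ word_of v].
Proof.
move=> cX [->|]; first by left.
case=> j jm [s s0]; rewrite sigma_word_recl//; case: (s j) => /= -[].
  by move=> /cX.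
by move=> xj <-; right; exists j, s.
Qed.

(* A word of [Delta] starting with a letter [x_i^(m)] is of the form
   [x_i^(m) sigma_(m+1) x_i^(m+1) ...]: if it comes from a final subword
   [x_i^(m) v], it also belongs to the set generated by [(i, m, v)]. *)
Lemma Delta_consX (e : equation n) i m u : Delta e (X i m :: u) ->
  (exists M k s v, [/\ S_eq e (i, Posz M, v), (k <= M)%N, m = Posz k,
     s 0%N = false &
     u = sigma_word Minus (fun j => X i (j%:Z)%R) s k.+1 M ++ word_of v]) \/
  (exists M k s v, [/\ S_eq e (i, Negz M, v), (k <= M.+1)%N, m = (- k%:Z)%R,
     s 0%N = false &
     u = sigma_word Plus (fun j => X i (- j%:Z)%R) s k.+1 M.+1 ++ word_of v]).
Proof.
move=> [//|[[[i' M] v] S Mu]].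
have [vE|nvE] := pselect (word_of v = X i m :: u).
  case: v S vE {Mu} => [//|[i0 m0] v] [FSv _] [? ? uE]; subst i0 m0.
  have {}S := S_eq_cons FSv; case: m S {FSv} => k S; [left|right].
    by exists k, k, xpred0, v; rewrite sigma_word_nil.
  by exists k, k.+1, xpred0, v; rewrite sigma_word_nil.
case: M S Mu => M S /Delta_gen_consX[]// [j [s [jM s0 [? ?] uE]]]; subst i' m.
  by left; exists M, j, s, v.
by right; exists M, j, s, v.
Qed.

(** With [w] read as b, these are the words for b - 1 and for the images of b and b - 1 under x^(k),
    as required to unfold one [pinvl]. *)
Lemma Delta_closed_pos (e : equation n) i k u (w := X i (Posz k.+1) :: u) :
  Delta e w ->
  [/\ Delta e (Minus :: w), Delta e (X i (Posz k) :: w)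
    & Delta e (X i (Posz k) :: Minus :: w)].
Proof.
case/Delta_consX=> -[M [j [s [v [S jM]]]]]; last by lia.
move=> [jE] s0 uE; subst j.
have [] := @Delta_gen_closed Minus (fun j => X i j%:Z%R) s k M v w.
- by [].
- by [].
- by rewrite /w uE.
by move=> *; split; apply: (Delta_S_eq S).
Qed.

Lemma Delta_closed_neg (e : equation n) i k u (w := X i (Negz k) :: u) :
  Delta e w ->
  [/\ Delta e (Plus :: w), Delta e (X i (- k%:Z)%R :: w)
    & Delta e (X i (- k%:Z)%R :: Plus :: w)].
Proof.
case/Delta_consX=> -[M [j [s [v [S jM]]]]]; first by [].
move=> jE s0 uE; have {jE} ? : j = k.+1 by lia.
subst j.
have [] := @Delta_gen_closed Plus (fun j => X i (- j%:Z)%R) s k M.+1 v w.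
- by [].
- by [].
- by rewrite /w uE.
by move=> *; split; apply: (Delta_S_eq S).
Qed.

Lemma Delta_joinand (e : equation n) w : w \in joinands e -> Delta e (word_of w).
Proof.
move=> we; have : FS e w by exists w, [::].
case: w {we} => [|[i m] v] FSv; first by left.
apply: (Delta_S_eq (S_eq_cons FSv)).
by case: m {FSv} => k; apply: Delta_gen_last.
Qed.

End SigmaWords.

(** * From an action on an integral chain to a compatible surjection *)

Section IntegralAction.
Context (n : nat) (T : Type) (le : T -> T -> Prop).
Hypothesis tle : total_preorder le.
Context (up down : T -> T) (f : 'I_n -> int -> T -> T) (p0 : T).
Local Open Scope ring_scope.
Hypothesis up_gt : forall p, ~ le (up p) p.
Hypothesis up_le : forall p z, ~ le z p -> le (up p) z.
Hypothesis down_lt : forall p, ~ le p (down p).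
Hypothesis down_ge : forall p z, ~ le p z -> le z (down p).
Hypothesis f_homo : forall i m, {homo f i m : x y / le x y}.
Hypothesis f_unit : forall i m x, le x (f i m (f i (m + 1) x)).
Hypothesis f_counit : forall i m x, le (f i (m + 1) (f i m x)) x.

Fixpoint word_act (u : word n) : T :=
  match u with
  | [::] => p0
  | X i m :: v => f i m (word_act v)
  | Plus :: v => up (word_act v)
  | Minus :: v => down (word_act v)
  end.

Lemma compatible_surjection_of_action (e : equation n) :
  (forall w, w \in joinands e -> ~ le p0 (word_act (word_of w))) ->
  exists (q : nat) (phi : word n -> 'I_q),
    compatible_surjection e phi /\ fails_in_surjection e phi.
Proof.
move=> fails; pose wle u v := le (word_act u) (word_act v).
have tw : total_preorder wle.
  by split=> [y x z|x y]; [apply: (tle_trans tle)|apply: tle.2].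
have D0 : Delta e [::] by left.
have [q [phi [phi_onto phi_le]]] := rank_exists tw (Delta_finite e) D0.
have phi_lt u v : Delta e u -> Delta e v ->
    ~ le (word_act v) (word_act u) -> (phi u < phi v)%N.
  by move=> Du Dv nvu; rewrite ltnNge; apply/negP => /(phi_le _ _ Dv Du).
(* Every rank comes from a word of [Delta], so nothing can fall between the ranks of two words whose
   values are consecutive in the chain. *)
have covers_up u v : Delta e u -> Delta e v -> ~ wle v u ->
    (forall w, ~ wle w u -> wle v w) -> covers (phi u) (phi v).
  move=> Du Dv vu vmin; split; first by rewrite ltEord phi_lt.
  move=> [c []]; have [w Dw <-] := phi_onto c; rewrite !ltEord => uw wv.
  have nwu : ~ wle w u by move/(phi_le _ _ Dw Du); rewrite leqNgt uw.
  by have /(phi_le _ _ Dv Dw) := vmin _ nwu; rewrite leqNgt wv.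
exists q, phi; split; last first.
  by move=> w we; rewrite ltEord phi_lt//; [apply: Delta_joinand|apply: fails].
split=> //.
- move=> i; split=> [a b b'|a a' b b' aa'].
    move=> [u [Du Dxu -> ->]] [v [Dv Dxv uv ->]]; apply/val_inj/eqP.
    rewrite eqn_leq; apply/andP; split; apply/phi_le => //; apply: f_homo.
      by apply/(phi_le u v) => //; rewrite uv.
    by apply/(phi_le v u) => //; rewrite uv.
  move=> [u [Du Dxu ua ->]] [v [Dv Dxv va ->]]; rewrite leEord.
  apply/phi_le => //; apply: f_homo; apply/(phi_le u v) => //.
  by rewrite -ua -va.
- move=> _ _ [[v [Dv Dpv -> ->]]|[v [Dv Dmv -> ->]]].
    by apply: covers_up => //; [apply: up_gt|move=> w; apply: up_le].
  apply: covers_up => //; first exact: down_lt.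
  move=> w nwm; apply: contrapT => /down_ge; exact: nwm.
have f_unit0 i (k : nat) x : le x (f i k (f i k.+1 x)).
  by have := f_unit i k x; rewrite (_ : k%:Z + 1 = k.+1)//; lia.
have f_counit0 i (k : nat) x : le (f i k.+1 (f i k x)) x.
  by have := f_counit i k x; rewrite (_ : k%:Z + 1 = k.+1)//; lia.
have f_unitN i (k : nat) x : le x (f i (Negz k) (f i (- k%:Z) x)).
  by have := f_unit i (Negz k) x; rewrite (_ : Negz k + 1 = - k%:Z)//; lia.
have f_counitN i (k : nat) x : le (f i (- k%:Z) (f i (Negz k) x)) x.
  by have := f_counit i (Negz k) x; rewrite (_ : Negz k + 1 = - k%:Z)//; lia.
have pos i (k : nat) u : Delta e u -> Delta e (X i k :: u) ->
    iter_pinv (cov_of e phi) (g_of e phi i) k (phi u) (phi (X i k :: u)).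
  elim: k u => [|k IH] u Du Dxu; first by exists u.
  have [Dm Dx Dxm] := Delta_closed_pos Dxu.
  exists (phi (Minus :: X i k.+1 :: u)).
  exists (phi (X i k :: Minus :: X i k.+1 :: u)), (phi (X i k :: X i k.+1 :: u)).
  split; [exact: IH|exact: IH| | |].
  - by right; exists (X i k.+1 :: u).
  (* If the value of [u] were below f^(k)(b - 1), with b its image under f^(k+1), then the counit
     would put b below b - 1. *)
  - rewrite ltEord phi_lt//= => le_u; apply: (@down_lt (f i k.+1 (word_act u))).
    exact: (tle_trans tle (f_homo i k.+1 le_u) (f_counit0 _ _ _)).
  - by rewrite leEord; apply/phi_le => //; apply: f_unit0.
have neg i (k : nat) u : Delta e u -> Delta e (X i (- k%:Z) :: u) ->
    iter k (pinvr (cov_of e phi)) (g_of e phi i) (phi u)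
      (phi (X i (- k%:Z) :: u)).
  elim: k u => [|k IH] u Du Dxu; first by exists u.
  rewrite -NegzE in Dxu *.
  have [Dp Dx Dxp] := Delta_closed_neg Dxu.
  exists (phi (Plus :: X i (Negz k) :: u)).
  exists (phi (X i (- k%:Z) :: X i (Negz k) :: u)),
    (phi (X i (- k%:Z) :: Plus :: X i (Negz k) :: u)).
  split; [exact: IH|exact: IH| | |].
  - by left; exists (X i (Negz k) :: u).
  - by rewrite leEord; apply/phi_le => //; apply: f_counitN.
  (* Dually, the unit would put b + 1 below b. *)
  - rewrite ltEord phi_lt//= => le_u; apply: (@up_gt (f i (Negz k) (word_act u))).
    exact: (tle_trans tle (f_unitN _ _ _) (f_homo i (Negz k) le_u)).
by move=> i [k|k] u; [apply: pos|rewrite NegzE; apply: (neg i k.+1)].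
Qed.

End IntegralAction.

(** * The chain of a prime filter, and the proof of the theorem *)

Section Embedding.
Context (d : Order.disp_t) (A : dlpgType d) (P : set A).
Local Open Scope group_scope.
Local Open Scope order_scope.
Hypothesis P_up : forall x y, x <= y -> P x -> P y.
Hypothesis P_meet : forall x y, P x -> P y -> P (x `&` y).
Hypothesis P_prime : forall x y, P (x `|` y) -> P x \/ P y.

Definition residual_le (x y : A) : Prop := forall z, P (z * x) -> P (z * y).

(** If [u] and [v] witness that [x] and [y] are incomparable, [P] contains the meet of [u * x] and
    [v * y], hence the join of [u * y] and [v * x], against primeness. *)
Lemma residual_le_preorder : total_preorder residual_le.
Proof.
split=> [y x z xy yz t /xy /yz //|x y].
apply: contrapT => /not_orP[/existsNP[u /not_implyP[ux nuy]]].
move=> /existsNP[v /not_implyP[vy nvx]].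
by case: (P_prime (P_up (meet_mul_le_join_mul u v x y) (P_meet ux vy))).
Qed.

Lemma le_residual x y : x <= y -> residual_le x y.
Proof. by move=> xy z; apply: P_up; apply: le_mul2l. Qed.

Lemma residual_le_mul a : {homo *%g a : x y / residual_le x y}.
Proof. by move=> x y xy z; rewrite !mulgA; apply: xy. Qed.

Lemma residual_unit a (m : int) x :
  residual_le x (iter_inv a m * (iter_inv a (m + 1)%R * x)).
Proof.
by apply: le_residual; rewrite mulgA -[leLHS]mul1g le_mul2r// le1_mul_iter_invS.
Qed.

Lemma residual_counit a (m : int) x :
  residual_le (iter_inv a (m + 1)%R * (iter_inv a m * x)) x.
Proof.
by apply: le_residual; rewrite mulgA -[leRHS]mul1g le_mul2r// iter_invS_mul_le1.
Qed.

End Embedding.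

Theorem theorem3p5 (n : nat) (e : equation n) :
  fails_in_DLPG e ->
  exists (q : nat) (phi : word n -> 'I_q),
    compatible_surjection e phi /\ fails_in_surjection e phi.
Proof.
move=> [d [A [h /prime_filter_exists[P [P1 Pj P_up P_meet P_prime]]]]].
pose le := residual_le P.
have tle : total_preorder le by apply: residual_le_preorder.
pose a i m (x : A) := (iter_inv (h i) m * x)%g.
have a_homo i m : {homo a i m : x y / le x y} by apply: residual_le_mul.
have a_unit i m x : le x (a i m (a i (m + 1)%R x)) by apply: residual_unit.
have a_counit i m x : le (a i (m + 1)%R (a i m x)) x by apply: residual_counit.
(* Restricting to the admissible points makes successor and predecessor total maps. *)
pose E := {p : A * int | ext_point le p}.
pose leE (p q : E) := ext_le le (sval p) (sval q).
have tleE : total_preorder leE.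
  have := ext_le_preorder tle.
  by case=> tr tot; split=> [y x z|x y]; [apply: tr|apply: tot].
have /choice[up upP] (p : E) :
    exists q : E, ~ leE q p /\ forall z, ~ leE z p -> leE q z.
  have [q [qE qp qmin]] := ext_succ_exists tle (svalP p).
  by exists (exist _ q qE); split=> // -[z zE]; apply: qmin.
have /choice[down downP] (p : E) :
    exists q : E, ~ leE p q /\ forall z, ~ leE p z -> leE z q.
  have [q [qE qp qmin]] := ext_pred_exists tle (svalP p).
  by exists (exist _ q qE); split=> // -[z zE]; apply: qmin.
have aE i m (p : E) : ext_point le (lift le (a i m) (sval p)).
  by apply: (@lift_ext_point _ _ tle (a i)) => //; apply: svalP.
pose f i m (p : E) : E := exist _ (lift le (a i m) (sval p)) (aE i m p).
have p0E : ext_point le (1%g, 0%R) by split.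
apply: (@compatible_surjection_of_action n E leE tleE up down f (exist _ _ p0E)).
- by move=> p; case: (upP p).
- by move=> p; case: (upP p).
- by move=> p; case: (downP p).
- by move=> p; case: (downP p).
- by move=> i m p q; apply: lift_homo.
- by move=> i m p; apply: (@lift_unit _ _ tle (a i)) => //; apply: svalP.
- by move=> i m p; apply: (@lift_counit _ _ tle (a i)) => //; apply: svalP.
(* Lifting leaves first coordinates unchanged, so testing the residual order at 1 puts the value of
   [w], and with it the join, into [P]. *)
move=> w we [] /(_ 1%g); rewrite /= mul1g => /(_ P1); set x := (sval _).1.
have -> : x = iword_eval h w.
  rewrite /x /iword_eval; elim: w {we x} => [|[i m] w IH]; first by rewrite big_nil.
  by rewrite big_cons /= IH.
by rewrite mul1g => Pw _; apply: Pj; apply: P_up Pw; apply: join_eval_ge.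
Qed.
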